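(* Let $s \ge 5$ be odd and let $X$ be an antipodal $s$-distance set in the unit sphere $S^{d-1}\subset\mathbb{R}^d$ with $B(X) = \{-1, \pm\beta_1, \pm\beta_2, \ldots, \pm\beta_{(s-1)/2}\}$ (a set of exactly $s$ elements). (1) Let $N = \binom{d+s-4}{s-3}$. If $|X| \ge 4N$, then for each $i = 1, \ldots, (s-1)/2$ the number \[ k_i = \prod_{j=1,\ldots,(s-1)/2,\ j \neq i} \frac{1 - \beta_j^2}{\beta_i^2 - \beta_j^2} \] is an integer, and $|k_i| \le U(N)$. (2) Let $N = \binom{d+s-3}{s-2}$. If $|X| \ge 4N + 2$, then for each $i = 1, \ldots, (s-1)/2$ the number \[ k_i = \frac{1}{\beta_i} \prod_{j=1,\ldots,(s-1)/2,\ j \neq i} \frac{1 - \beta_j^2}{\beta_i^2 - \beta_j^2} \] is an integer, and $|k_i| \le \left\lfloor \sqrt{2N^2/(N+1)} \right\rfloor$.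
   Context: A finite set $X \subset \mathbb{R}^d$ is an $s$-distance set if the set of Euclidean distances between distinct points of $X$ has exactly $s$ elements. $X$ is antipodal if $-x \in X$ for every $x \in X$. For $X \subset S^{d-1}$, $B(X) = \{(x,y) : x, y \in X, x \neq y\}$, where $(\cdot,\cdot)$ is the standard inner product. The function $U$ is defined by $U(N) = \left\lfloor \frac{1}{2} + \sqrt{\frac{N^2}{2N-2} + \frac{1}{4}} \right\rfloor$. *)

(* Defs.v *)
From HB Require Import structures.
From mathcomp Require Import all_boot all_order all_algebra.
From mathcomp Require Import reals.
Set Implicit Arguments. Unset Strict Implicit. Unset Printing Implicit Defensive.
Import Order.TTheory GRing.Theory Num.Theory.
Local Open Scope ring_scope.

Definition dotp (R : realType) (d : nat) (u v : 'rV[R]_d) : R := (u *m v^T) 0 0.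

Definition edist (R : realType) (d : nat) (u v : 'rV[R]_d) : R :=
  Num.sqrt (dotp (u - v) (u - v)).

Definition dpairs (R : realType) (d : nat) (X : seq 'rV[R]_d) :=
  [seq p <- allpairs pair X X | p.1 != p.2].

Definition dist_set (R : realType) (d : nat) (X : seq 'rV[R]_d) : seq R :=
  undup [seq edist p.1 p.2 | p <- dpairs X].

Definition s_distance_set (R : realType) (d s : nat) (X : seq 'rV[R]_d) : Prop :=
  uniq X /\ size (dist_set X) = s.

Definition on_unit_sphere (R : realType) (d : nat) (X : seq 'rV[R]_d) : Prop :=
  forall x, x \in X -> dotp x x = 1.

Definition antipodal (R : realType) (d : nat) (X : seq 'rV[R]_d) : Prop :=
  forall x, x \in X -> - x \in X.

Definition Bset (R : realType) (d : nat) (X : seq 'rV[R]_d) : seq R :=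
  undup [seq dotp p.1 p.2 | p <- dpairs X].

Definition U (R : realType) (N : nat) : int :=
  Num.floor (2^-1 + Num.sqrt ((N%:R : R) ^+ 2 / (2 * N%:R - 2) + 4^-1)).

Definition V (R : realType) (N : nat) : int :=
  Num.floor (Num.sqrt (2 * (N%:R : R) ^+ 2 / (N%:R + 1))).

(* Main.v *)
(* Keep one point of each antipodal pair, giving n = |X|/2 points, and let f
   be the even (resp. odd) polynomial with f(1) = k and f(beta_j) = 0 for
   j <> i, f(beta_i) = 1. The matrix M = (f(x . y)) is k I + A with A having
   entries 0, 1 (resp. 0, 1, -1), and its rank is at most N, the dimension of
   the space of forms of degree s - 3 (resp. s - 2); in the even case the same
   holds for M + c J, where J is the all-one matrix. Hence - k is an eigenvalue
   of the integer matrix A of multiplicity at least n - N, too large for k to be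
   irrational; when n = 2N in the even case, compare A with A - J. The bounds
   follow from (tr B)^2 <= rank(B) tr(B B^T) for B = 2M - J (resp. B = M). *)
Require Import Defs.
From HB Require Import structures.
From mathcomp Require Import all_boot all_order all_algebra all_field.
From mathcomp Require Import boolp reals.
From mathcomp Require Import zify ring lra.
Import Order.TTheory GRing.Theory Num.Theory.
Local Open Scope ring_scope.

Set Implicit Arguments.
Unset Strict Implicit.

(** * Traces of Gram matrices and the trace-rank inequality *)

Lemma mxtrace_trmx_mul (R : comNzRingType) (m n : nat) (A B : 'M[R]_(m, n)) :
  \tr (A *m B^T) = \sum_i \sum_j A i j * B i j.
Proof.
by apply: eq_bigr => i _; rewrite mxE; apply: eq_bigr => j _; rewrite mxE.
Qed.

Lemma mxtrace_gram_ge0 (R : realFieldType) (m n : nat) (A : 'M[R]_(m, n)) :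
  0 <= \tr (A *m A^T).
Proof.
by rewrite mxtrace_trmx_mul; do 2!apply: sumr_ge0 => ? _; rewrite -expr2 sqr_ge0.
Qed.

Lemma mxtrace_gram_eq0 (R : realFieldType) (m n : nat) (A : 'M[R]_(m, n)) :
  \tr (A *m A^T) = 0 -> A = 0.
Proof.
rewrite mxtrace_trmx_mul => A0; apply/matrixP => i j; rewrite mxE.
have ge0 k l : 0 <= A k l * A k l by rewrite -expr2 sqr_ge0.
have /(_ i isT)/eqP := psumr_eq0P (fun k _ => sumr_ge0 _ (fun l _ => ge0 k l)) A0.
rewrite psumr_eq0 // => /allP/(_ j (mem_index_enum _))/=.
by rewrite mulf_eq0 orbb => /eqP.
Qed.

(** If [K] annihilates [B *m B^T], then [K *m B] has zero Gram trace, hence vanishes, and freeness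
    of [B] gives [K = 0]. *)
Lemma gram_unitmx (R : realFieldType) (m n : nat) (B : 'M[R]_(m, n)) :
  row_free B -> B *m B^T \in unitmx.
Proof.
move=> Bfree; rewrite -row_free_unit -kermx_eq0; apply/eqP.
set K := kermx _; have K0 : K *m (B *m B^T) = 0 by exact: mulmx_ker.
apply: (row_free_inj Bfree); rewrite mul0mx; apply: mxtrace_gram_eq0.
by rewrite trmx_mul -mulmxA [B *m _]mulmxA mulmxA K0 mul0mx mxtrace0.
Qed.

(* With Q the orthogonal projection onto the row space of M, this is the
   Cauchy-Schwarz inequality for the Frobenius product of M = M Q and Q. *)
Lemma sqr_mxtrace_le_rank (R : realFieldType) (n : nat) (M : 'M[R]_n) :
  (\tr M) ^+ 2 <= (\rank M)%:R * \tr (M *m M^T).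
Proof.
have [B Bfree [C CB]] : exists2 B : 'M[R]_(\rank M, n), row_free B & exists C, C *m B = M.
  by exists (row_base M); [exact: row_base_free | exists (col_base M); exact: mulmx_base].
pose G := B *m B^T; have Gu : G \in unitmx by exact: gram_unitmx.
have GT : G^T = G by rewrite /G trmx_mul trmxK.
pose Q := B^T *m invmx G *m B.
have QT : Q^T = Q by rewrite /Q !trmx_mul trmxK trmx_inv GT mulmxA.
have BQ : B *m Q = B by rewrite /Q !mulmxA mulmxV // mul1mx.
have QQ : Q *m Q = Q by rewrite {1}/Q -mulmxA BQ.
have MQ : M *m Q = M by rewrite -{1}CB -mulmxA BQ CB.
have trQ : \tr Q = (\rank M)%:R.
  by rewrite /Q mxtrace_mulC mulmxA mulmxV // mxtrace1.
case: (eqVneq (\rank M) 0%N) => [r0 | rn0].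
  by move/eqP: r0; rewrite mxrank_eq0 => /eqP ->; rewrite mxtrace0 mul0mx mxtrace0 expr0n mulr0.
set r : R := (\rank M)%:R; have r0 : 0 < r by rewrite ltr0n lt0n.
have := mxtrace_gram_ge0 (r *: M - \tr M *: Q).
have -> : (r *: M - \tr M *: Q)^T = r *: M^T - \tr M *: Q.
  by rewrite linearB /= !linearZ /= QT.
have QMT : Q *m M^T = M^T by rewrite -[in RHS]MQ trmx_mul QT.
rewrite mulmxBl !mulmxBr -!scalemxAl -!scalemxAr QQ MQ QMT.
rewrite !linearB /= !linearZ /= mxtrace_tr trQ -/r.
set t := \tr M; set f := \tr _ => H.
rewrite -subr_ge0 -(pmulr_rge0 _ r0); lra.
Qed.

(** * Eigenvalue multiplicity in the characteristic polynomial *)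

(** Each row of index at least [r] is [t] times the matching row of [S], so [n - r] factors [t] come
    out. *)
Lemma det_scale_sub_pid (R : comNzRingType) (n r : nat) (t : R) (S : 'M[R]_n) :
  (r <= n)%N ->
  exists c, \det (t *: S - pid_mx r) = t ^+ (n - r) * c.
Proof.
move=> rn.
pose D : 'rV[R]_n := \row_i (if (i < r)%N then 1 else t).
pose S' : 'M[R]_n := \matrix_(i, j) (if (i < r)%N then t * S i j - (i == j)%:R else S i j).
exists (\det S'); have -> : t *: S - pid_mx r = diag_mx D *m S'.
  apply/matrixP => i j; rewrite mul_diag_mx !mxE.
  by case: ifP => ir; rewrite ?mul1r ?andbT ?andbF ?subr0.
rewrite det_mulmx det_diag; congr (_ * _).
under eq_bigr do rewrite mxE.
rewrite (bigID (fun i : 'I_n => (i < r)%N)) /= big1 ?mul1r; last by move=> i ->.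
rewrite (eq_bigr (fun=> t)); last by move=> i /negbTE ->.
rewrite prodr_const; congr (_ ^+ _).
have widen_inj : injective (widen_ord rn) by move=> x y /(congr1 val)/= xy; apply: val_inj.
have <- : #|predC [pred i : 'I_n | (i < r)%N]| = #|[pred i : 'I_n | ~~ (i < r)%N]|.
  by apply: eq_card => i; rewrite !inE.
rewrite -[X in (X - _)%N](card_ord n) -(cardC [pred i : 'I_n | (i < r)%N]).
suff -> : #|[pred i : 'I_n | (i < r)%N]| = r by rewrite addKn.
rewrite -[RHS](card_ord r) -(card_imset _ widen_inj).
apply: eq_card => i; rewrite !inE; apply/idP/imsetP => [ir|[j _ ->]]; last exact: (ltn_ord j).
by exists (Ordinal ir) => //; apply: val_inj.
Qed.

(** Algebraic multiplicity is at least geometric multiplicity. Since [A - a%:M] is [pid_mx r]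
    between invertible [L] and [U], taking these out of the characteristic matrix leaves a
    determinant as in [det_scale_sub_pid]. *)
Lemma char_poly_dvdp_rank (F : fieldType) (n : nat) (A : 'M[F]_n) (a : F) :
  ('X - a%:P) ^+ (n - \rank (A - a%:M)) %| char_poly A.
Proof.
set M := A - a%:M; pose r := \rank M.
pose L := map_mx polyC (col_ebase M); pose U := map_mx polyC (row_ebase M).
have Lu : L \in unitmx by rewrite map_unitmx col_ebase_unit.
have Uu : U \in unitmx by rewrite map_unitmx row_ebase_unit.
have [c Hc] := @det_scale_sub_pid _ n r ('X - a%:P) (invmx L *m invmx U) (rank_leq_row M).
have -> : char_poly A = \det (L *m (('X - a%:P) *: (invmx L *m invmx U) - pid_mx r) *m U).
  rewrite /char_poly /char_poly_mx; congr (\det _).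
  rewrite mulmxBr mulmxBl -scalemxAr -scalemxAl !mulmxA mulmxV // mul1mx mulVmx //.
  rewrite -(map_pid_mx polyC) -!map_mxM mulmx_ebase /M map_mxB map_scalar_mx.
  by rewrite -scalemx1 scalerBl !scalemx1 opprB addrA subrK.
by rewrite !det_mulmx Hc dvdp_mulr // dvdp_mull // dvdp_mulr.
Qed.

(** * Integrality of roots of high multiplicity *)

(** A simple root of [p] absorbs only one factor ['X - a%:P]; the others must divide [q]. *)
Lemma dvdp_exp_XsubC_mul (R : idomainType) (a : R) (m : nat) (p q : {poly R}) :
  root p a -> ~~ root p^`() a ->
  ('X - a%:P) ^+ m.+1 %| p * q -> ('X - a%:P) ^+ m %| q.
Proof.
move=> /factor_theorem [p1 ->]; rewrite derivM derivXsubC mulr1 => pa.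
have p1a : ~~ root p1 a.
  apply: contra pa => /rootP p1a.
  by rewrite /root hornerD hornerM p1a hornerXsubC subrr mulr0 addr0.
rewrite exprSr mulrAC dvdp_mul2r ?polyXsubC_eq0 // Gauss_dvdpr //.
by apply: coprimep_expl; rewrite coprimep_sym coprimep_XsubC.
Qed.

Lemma root_of_dvdp_exp (R : fieldType) (a : R) (m : nat) (p : {poly R}) :
  (0 < m)%N -> ('X - a%:P) ^+ m %| p -> root p a.
Proof.
move=> m0 pm; rewrite -dvdp_XsubCl; apply: dvdp_trans pm.
by rewrite -(prednK m0) exprS dvdp_mulr.
Qed.

(* A polynomial q of least degree over F vanishing at a has a as a simple
   root, so q ^+ m divides g and q is linear. *)
Lemma root_in_subfield (F : fieldType) (R : fieldType) (f : {rmorphism F -> R})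
    (g : {poly F}) (a : R) (m : nat) :
  [pchar F] =i pred0 -> g != 0 ->
  ('X - a%:P) ^+ m %| map_poly f g -> (0 < m)%N -> (size g <= 2 * m)%N ->
  exists q : F, a = f q.
Proof.
move=> F0 g0 gm m0 gs.
have ga := root_of_dvdp_exp m0 gm.
have [q [q0 qa qmin]] : exists q : {poly F}, [/\ q != 0, root (map_poly f q) a &
    forall p, p != 0 -> root (map_poly f p) a -> (size q <= size p)%N].
  pose P n := `[< exists p, [/\ p != 0, root (map_poly f p) a & size p = n] >].
  have exP : exists n, P n by exists (size g); apply/asboolP; exists g.
  have [n /asboolP [q [q0 qa <-]] qmin] := ex_minnP exP.
  by exists q; split=> // p p0 pa; apply: qmin; apply/asboolP; exists p.
have size_q : (1 < size q)%N.
  by rewrite -(size_map_poly f); apply: root_size_gt1 qa; rewrite map_poly_eq0.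
(* In characteristic zero the top coefficient of the derivative is the degree times the leading
   coefficient of [q], hence nonzero. *)
have q'0 : q^`() != 0.
  apply/negP => /eqP/(congr1 (fun p : {poly F} => p`_((size q).-2)))/eqP.
  rewrite coef_deriv coef0 prednK; last by case: (size q) size_q => [|[]].
  rewrite -/(lead_coef q) -mulr_natr mulf_eq0 lead_coef_eq0 (negbTE q0) /=.
  by rewrite pcharf0P in F0; rewrite F0; case: (size q) size_q => [|[]].
have q'a : ~~ root (map_poly f q)^`() a.
  rewrite deriv_map; apply/negP => /(qmin _ q'0).
  by rewrite leqNgt lt_size_deriv.
have dvd n p : ('X - a%:P) ^+ n %| map_poly f p -> q ^+ n %| p.
  elim: n p => [|n IH] p; first by rewrite !expr0 !dvd1p.
  move=> pa; have := root_of_dvdp_exp (ltn0Sn n) pa.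
  rewrite {1}(divp_eq p q) rmorphD rmorphM /= => /rootP.
  rewrite hornerD hornerM (rootP qa) mulr0 add0r => /rootP ra.
  (* The remainder of [p] modulo [q] vanishes at [a], so minimality of [q] makes it zero. *)
  have qp : q %| p.
    apply: contraT => r0; have := qmin _ r0 ra.
    by rewrite leqNgt ltn_modp q0.
  move: pa; rewrite -(divpK qp) rmorphM /= [X in _ %| X]mulrC.
  move=> /(dvdp_exp_XsubC_mul qa q'a)/IH.
  by rewrite exprSr => /dvdp_mul; apply.
(* Size is degree plus one: [q ^+ m] divides [g], whose degree is below [2 * m], so the degree of
   [q] is below 2. *)
have size_q2 : size q = 2%N.
  have qmg : (size (q ^+ m)%R <= size g)%N by exact: dvdp_leq g0 (dvd _ _ gm).
  have qmE : size (q ^+ m)%R = ((size q).-1 * m).+1.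
    by rewrite -size_exp prednK // size_poly_gt0 expf_neq0.
  rewrite qmE in qmg; have := leq_trans qmg gs; move: size_q m0.
  clear; case: (size q) => [//|[//|k]] _ /=; case: k => [//|k]; nia.
have [r qr] := poly2_root size_q2; exists r; apply/eqP; apply: contraT => ar.
have : all (root (map_poly f q)) [:: a; f r] by rewrite /= qa rmorph_root.
move=> /max_poly_roots; rewrite map_poly_eq0 q0 size_map_poly size_q2 /= inE ar => H.
by have := H isT isT.
Qed.

(** The root is an algebraic integer, and a rational algebraic integer is an integer; hence the
    passage through [algC]. *)
Lemma int_of_rat_root (p : {poly int}) (a : rat) :
  p \is monic -> root (map_poly intr p) a -> a \is a Num.int.
Proof.
move=> pmon pa.
have mapp : map_poly ratr (map_poly intr p) = map_poly intr p :> {poly algC}.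
  by rewrite -map_poly_comp; apply: eq_map_poly => z /=; rewrite ratr_int.
have ratr_Aint : (ratr a : algC) \in Aint.
  apply: (@root_monic_Aint (map_poly intr p)).
  - by rewrite -mapp fmorph_root.
  - by rewrite monic_map.
  - by apply/polyOverP => i; rewrite coef_map /= intr_int.
have /intrP [z az] := Cint_rat_Aint (Crat_rat a) ratr_Aint.
have -> : a = z%:~R by move: az; rewrite -(ratr_int _ z) => /fmorph_inj.
exact: intr_int.
Qed.

(** The multiplicity in [g] makes [a] rational, then the monic [p] makes it an integer. The two are
    kept apart because [g] may be a difference of characteristic polynomials, which need not be
    monic. *)
Lemma int_of_multiple_root (R : archiRealFieldType) (p g : {poly int}) (a : R) (m : nat) :
  p \is monic -> root (map_poly intr p) a ->
  g != 0 -> ('X - a%:P) ^+ m %| map_poly intr g -> (0 < m)%N -> (size g <= 2 * m)%N ->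
  a \is a Num.int.
Proof.
move=> pmon pa g0 gm m0 gs.
have mapE (q : {poly int}) : map_poly ratr (map_poly intr q) = map_poly intr q :> {poly R}.
  by rewrite -map_poly_comp; apply: eq_map_poly => z /=; rewrite ratr_int.
have gQ0 : map_poly intr g != 0 :> {poly rat} by rewrite map_poly_eq0_id0 // intr_eq0 lead_coef_eq0.
have gQm : ('X - a%:P) ^+ m %| map_poly ratr (map_poly intr g : {poly rat}) by rewrite mapE.
have gQs : (size (map_poly intr g : {poly rat}) <= 2 * m)%N by apply: leq_trans (size_poly _ _) gs.
have [q aq] := root_in_subfield (pchar_num _) gQ0 gQm m0 gQs.
have /intrP [z qz] : q \is a Num.int.
  by apply: (int_of_rat_root pmon); rewrite -(fmorph_root (@ratr R)) mapE -aq.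
by rewrite aq qz rmorph_int intr_int.
Qed.

(** * Low-rank matrices: integral eigenvalues and size of the diagonal *)

Lemma char_poly_int_dvdp_rank (R : numFieldType) (n N : nat) (A : 'M[int]_n) (k : R) :
  (\rank (k%:M + map_mx intr A)%R <= N)%N ->
  ('X - (- k)%:P) ^+ (n - N) %| map_poly intr (char_poly A).
Proof.
move=> rk; rewrite map_char_poly.
apply: dvdp_trans (char_poly_dvdp_rank (map_mx intr A) (- k)).
by rewrite dvdp_exp2l // leq_sub2l // rmorphN opprK addrC.
Qed.

(** The characteristic polynomial has size [n + 1], and [2 * N < n] says exactly that
    [n + 1 <= 2 * (n - N)]. *)
Lemma int_eigenvalue (R : archiRealFieldType) (n N : nat) (A : 'M[int]_n) (k : R) :
  (2 * N < n)%N -> (\rank (k%:M + map_mx intr A)%R <= N)%N -> k \is a Num.int.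
Proof.
move=> Nn /char_poly_int_dvdp_rank pm; rewrite -rpredN.
have m0 : (0 < n - N)%N by lia.
have monA := char_poly_monic A.
apply: (int_of_multiple_root monA (root_of_dvdp_exp m0 pm) (monic_neq0 monA) pm m0).
by rewrite size_char_poly; lia.
Qed.

(* The difference of the two characteristic polynomials has degree less than n
   and still vanishes at - k to order n - N. *)
Lemma int_common_eigenvalue (R : archiRealFieldType) (n N : nat) (A B : 'M[int]_n) (k : R) :
  (2 * N <= n)%N -> \tr A != \tr B ->
  (\rank (k%:M + map_mx intr A)%R <= N)%N -> (\rank (k%:M + map_mx intr B)%R <= N)%N ->
  k \is a Num.int.
Proof.
move=> Nn trAB /char_poly_int_dvdp_rank pA /char_poly_int_dvdp_rank pB; rewrite -rpredN.
have n0 : (0 < n)%N.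
  by case: n A B trAB {Nn pA pB} => // A B; rewrite !flatmx0 eqxx.
have m0 : (0 < n - N)%N by lia.
(* The coefficient of index [n.-1] is minus the trace, so distinct traces keep the difference
   nonzero. *)
have coefAB : (char_poly A - char_poly B)`_n.-1 != 0.
  by rewrite coefB !char_poly_trace // opprK addrC subr_eq0 eq_sym.
apply: (@int_of_multiple_root _ (char_poly A) (char_poly A - char_poly B) _ (n - N)) => //.
- exact: char_poly_monic.
- exact: root_of_dvdp_exp m0 pA.
- by apply: contraNneq coefAB => ->; rewrite coef0.
- by rewrite rmorphB /= dvdp_sub.
apply: leq_trans (_ : n <= _)%N; last by lia.
apply/leq_sizeP => j; rewrite leq_eqVlt => /predU1P [<-|nj].
  have lead1 (C : 'M[int]_n) : (char_poly C)`_n = 1.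
    by have /monicP := char_poly_monic C; rewrite /lead_coef size_char_poly.
  by rewrite coefB !lead1 subrr.
by rewrite coefB !nth_default ?subrr // size_char_poly.
Qed.

(** The trace is [n * k] and the squared Frobenius norm at most [n * (k ^+ 2 + n - 1)]; insert both
    in [sqr_mxtrace_le_rank] and divide by [n]. *)
Lemma sqr_diag_le_rank (R : realFieldType) (n N : nat) (M : 'M[R]_n) (k : R) :
  (0 < n)%N -> (forall i, M i i = k) -> (forall i j, i != j -> M i j ^+ 2 <= 1) ->
  (\rank M <= N)%N ->
  k ^+ 2 * (n%:R - N%:R) <= N%:R * (n%:R - 1).
Proof.
move=> n0 Mii Mij rM.
have trM : \tr M = n%:R * k.
  rewrite /mxtrace (eq_bigr (fun=> k)) // sumr_const card_ord.
  by rewrite mulr_natl.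
have trMM : \tr (M *m M^T) <= n%:R * (k ^+ 2 + (n%:R - 1)).
  rewrite mxtrace_trmx_mul mulr_natl -[X in _ *+ X]card_ord -sumr_const.
  apply: ler_sum => i _; rewrite (bigD1 i) //= Mii -expr2 lerD2l.
  apply: le_trans (_ : \sum_(j < n | j != i) 1 <= _).
    by apply: ler_sum => j ji; rewrite -expr2 Mij // eq_sym.
  rewrite sumr_const cardC1 card_ord -[X in _ <= X%:R - _](prednK n0).
  by rewrite -natr1 addrK.
have := le_trans (sqr_mxtrace_le_rank M) (_ : _ <= N%:R * (n%:R * (k ^+ 2 + (n%:R - 1)))).
rewrite trM => /(_ _) H.
have n0' : 0 < n%:R :> R by rewrite ltr0n.
have {}H : (n%:R * k) ^+ 2 <= N%:R * (n%:R * (k ^+ 2 + (n%:R - 1))).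
  by apply: H; apply: ler_pM => //; rewrite ?ler_nat // mxtrace_gram_ge0.
rewrite -(ler_pM2l n0'); lra.
Qed.

(** * Inner products and polynomial functions on the sphere *)

Lemma dotpE (R : realType) (d : nat) (u v : 'rV[R]_d) :
  dotp u v = \sum_i u 0 i * v 0 i.
Proof. by rewrite /dotp mxE; apply: eq_bigr => i _; rewrite mxE. Qed.

Lemma dotpC (R : realType) (d : nat) (u v : 'rV[R]_d) : dotp u v = dotp v u.
Proof. by rewrite !dotpE; apply: eq_bigr => i _; rewrite mulrC. Qed.

Lemma dotp_sqrD (R : realType) (d : nat) (u v : 'rV[R]_d) :
  dotp (u + v) (u + v) = dotp u u + dotp u v *+ 2 + dotp v v.
Proof.
rewrite !dotpE -sumrMnl -!big_split; apply: eq_bigr => i _ /=.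
by rewrite !mxE; ring.
Qed.

Lemma dotp_eq0 (R : realType) (d : nat) (u : 'rV[R]_d) : dotp u u = 0 -> u = 0.
Proof. by move=> u0; apply: mxtrace_gram_eq0; rewrite trace_mx11. Qed.

(* The rows of Phi are the monomials of degree e, indexed by sorted tuples. On
   the sphere a monomial of degree m agrees with a sum of monomials of degree
   m + 2, since x_1^2 + ... + x_d^2 = 1. *)
Lemma dotp_poly_row_space (R : realType) (d n e : nat) (y : 'I_n -> 'rV[R]_d.+1) :
  (forall b, dotp (y b) (y b) = 1) ->
  exists Phi : 'M[R]_('C(e + d, e), n),
    forall (x : 'rV[R]_d.+1) (cs : seq R) (l j : nat),
      (2 * size cs + l + 2 * j = e)%N ->
      (\row_b (\prod_(c <- cs) (dotp x (y b) ^+ 2 - c) * dotp x (y b) ^+ l)%R <= Phi)%MS.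
Proof.
move=> y1; rewrite -card_sorted_tuples.
set S := [set t | _].
pose mono (b : 'I_n) (s : seq 'I_d.+1) := \prod_(i <- s) y b 0 i.
pose Phi : 'M[R]_(#|S|, n) := \matrix_(i < #|S|, b < n) mono b (tval (enum_val i)); exists Phi.
have mono_top s : size s = e -> (\row_b mono b s <= Phi)%MS.
  move=> se; pose leo := relpre (val : 'I_d.+1 -> nat) leq.
  have size_t : size (sort leo s) == e by rewrite size_sort se.
  have tS : Tuple size_t \in S.
    rewrite inE /= sorted_map; apply: sort_sorted => i j; exact: leq_total.
  apply: (eq_row_sub (enum_rank_in tS (Tuple size_t))); apply/rowP => b.
  rewrite !mxE enum_rankK_in //= /mono.
  by apply: perm_big; rewrite perm_sort.
have mono_sub j : forall s, (size s + 2 * j = e)%N -> (\row_b mono b s <= Phi)%MS.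
  elim: j => [|j IH] s sj; first by apply: mono_top; lia.
  have -> : \row_b mono b s = \sum_i \row_b mono b [:: i, i & s].
    apply/rowP => b; rewrite summxE mxE -[LHS]mul1r -(y1 b) dotpE mulr_suml.
    by apply: eq_bigr => i _; rewrite mxE /mono !big_cons mulrA.
  by apply: summx_sub => i _; apply: IH => /=; lia.
(* Expanding one factor [dotp x (y b)] in coordinates moves one index into [s]. *)
have pow_sub x j l : forall s, (l + size s + 2 * j = e)%N ->
    (\row_b (dotp x (y b) ^+ l * mono b s)%R <= Phi)%MS.
  elim: l => [|l IH] s lj.
    under eq_mx do rewrite expr0 mul1r.
    by apply: (mono_sub j); lia.
  have -> : \row_b (dotp x (y b) ^+ l.+1 * mono b s) =
      \sum_i x 0 i *: \row_b (dotp x (y b) ^+ l * mono b (i :: s)).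
    apply/rowP => b; rewrite summxE mxE exprSr -mulrA [X in _ * (X * _)]dotpE.
    rewrite mulr_suml mulr_sumr; apply: eq_bigr => i _.
    by rewrite !mxE /mono big_cons; ring.
  by apply: summx_sub => i _; apply/scalemx_sub/IH => /=; lia.
move=> x cs; elim: cs => [|c cs IH] l j lj.
  rewrite (_ : \row_b _ = \row_b (dotp x (y b) ^+ l * mono b [::])).
    by apply: (pow_sub x j l [::]); move: lj => /=; lia.
  by apply/rowP => b; rewrite !mxE /mono !big_nil mul1r mulr1.
(* The square in the first factor raises [l] by 2; the constant [c] loses two degrees, restored by
   raising [j] by 1. *)
have -> : \row_b (\prod_(c0 <- c :: cs) (dotp x (y b) ^+ 2 - c0) * dotp x (y b) ^+ l) =
    \row_b (\prod_(c0 <- cs) (dotp x (y b) ^+ 2 - c0) * dotp x (y b) ^+ l.+2)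
    - c *: \row_b (\prod_(c0 <- cs) (dotp x (y b) ^+ 2 - c0) * dotp x (y b) ^+ l).
  by apply/rowP => b; rewrite !mxE big_cons !exprS; ring.
by move: lj => /= lj; apply: addmx_sub; [apply: (IH _ j) | rewrite eqmx_opp; apply: scalemx_sub; apply: (IH _ j.+1)]; lia.
Qed.

(** * Antipodal sets and their inner products *)

(** Keep the member of each pair that occurs first in [X]. Negation permutes [X] and exchanges kept
    and dropped points, so exactly half remain. *)
Lemma antipodal_half (R : realType) (d : nat) (X : seq 'rV[R]_d) :
  uniq X -> antipodal X -> 0 \notin X ->
  exists Y : seq 'rV[R]_d, [/\ uniq Y, {subset Y <= X}, size X = (2 * size Y)%N &
    forall u v, u \in Y -> v \in Y -> u != - v].
Proof.
move=> uX aX X0; pose P u := (index u X < index (- u) X)%N.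
have PN u : u \in X -> P (- u) = ~~ P u.
  move=> uX'; rewrite /P opprK -leqNgt ltn_neqAle; case: eqP => //= E.
  suff : u = 0 by move=> u0; rewrite u0 (negbTE X0) in uX'.
  have : u = - u by rewrite -[LHS](nth_index 0 uX') -E nth_index // aX.
  by move/eqP; rewrite -addr_eq0 -mulr2n -scaler_nat scaler_eq0 pnatr_eq0 => /eqP.
exists (filter P X); split.
- exact: filter_uniq.
- by move=> u; rewrite mem_filter => /andP[].
- rewrite size_filter -(count_predC P) mul2n -addnn; congr (_ + _)%N.
  have pX : perm_eq (map -%R X) X.
    apply: uniq_perm => //; first by rewrite map_inj_uniq //; apply: oppr_inj.
    move=> u; apply/mapP/idP => [[v vX ->]|uX']; first exact: aX.
    by exists (- u); rewrite ?opprK ?aX.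
  rewrite -(permP pX P) count_map; apply: eq_in_count => u uX' /=.
  by rewrite PN.
move=> u v; rewrite !mem_filter => /andP[Pu uX'] /andP[Pv vX].
by apply: contraTneq Pu => ->; rewrite PN // Pv.
Qed.

Lemma int_mx_lift (R : archiRealDomainType) (m n : nat) (B : 'M[R]_(m, n)) :
  (forall i j, B i j \is a Num.int) -> exists A : 'M[int]_(m, n), B = map_mx intr A.
Proof.
move=> Bint; exists (map_mx Num.floor B).
by apply/matrixP => i j; rewrite !mxE floorK.
Qed.

(** On the sphere the distance is a function of the inner product [t], namely the square root of
    [2 - 2 * t]. *)
Lemma size_dist_set_le (R : realType) (d : nat) (X : seq 'rV[R]_d) :
  on_unit_sphere X -> (size (dist_set X) <= size (Bset X))%N.
Proof.
move=> X1; rewrite -(size_map (fun t => Num.sqrt (2 - 2 * t)) (Bset X)).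
apply: uniq_leq_size; first exact: undup_uniq.
move=> t; rewrite mem_undup => /mapP [p pX ->].
have /andP[p1X p2X] : (p.1 \in X) && (p.2 \in X).
  by move: pX; rewrite mem_filter => /andP[_ /allpairsP[q [q1 q2 ->]]]; rewrite q1 q2.
apply/mapP; exists (dotp p.1 p.2).
  by rewrite mem_undup; apply/mapP; exists p.
rewrite /edist; congr Num.sqrt.
have dotpN (u v : 'rV[R]_d) : dotp u (- v) = - dotp u v.
  by rewrite !dotpE -sumrN; apply: eq_bigr => i _; rewrite mxE mulrN.
rewrite dotp_sqrD !dotpN (dotpC (- _)) dotpN opprK (X1 _ p1X) (X1 _ p2X); ring.
Qed.

(** Distinctness comes from counting: [s] distances require at least [s] inner products, while the
    list of values has length [s], so it has no repetition. *)
Lemma Bset_beta (R : realType) (d s : nat) (X : seq 'rV[R]_d) (beta : 'I_(s.-1./2) -> R) :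
  odd s -> on_unit_sphere X -> s_distance_set s X ->
  Bset X =i (-1) :: [seq beta i | i <- enum 'I_(s.-1./2)]
                 ++ [seq - beta i | i <- enum 'I_(s.-1./2)] ->
  [/\ (forall i, beta i != 0), (forall i j, i != j -> beta i ^+ 2 != beta j ^+ 2) &
    forall u v, u \in X -> v \in X -> u != v -> u != - v ->
      exists i, dotp u v ^+ 2 = beta i ^+ 2].
Proof.
move=> s_odd X1 [uX sX] BX.
set L := _ :: _ in BX.
have size_L : size L = s.
  by rewrite /L -cat1s !size_cat (size_map beta) (size_map (fun i => - beta i)) !size_enum_ord [size [:: _]]/=; move: s_odd; lia.
have : uniq L.
  apply: (leq_size_uniq (undup_uniq _ : uniq (Bset X))) => [t|]; first by rewrite BX.
  by rewrite size_L -{1}sX size_dist_set_le.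
rewrite /L /= cat_uniq => /and4P[_ u1 /hasPn disj _].
have disjP i j : beta i != - beta j.
  apply/negP => /eqP ij; have := disj (- beta j) (map_f _ (mem_enum _ j)).
  by rewrite -ij map_f // mem_enum.
split.
- by move=> i; apply: contraNneq (disjP i i) => ->; rewrite oppr0.
- move=> i j ij; rewrite eqf_sqr negb_or disjP andbT.
  apply: contraNneq ij => bij.
  by have /injectiveP beta_inj : injectiveb beta := u1; exact/eqP/beta_inj.
move=> u v uX' vX uv uNv.
have : dotp u v \in Bset X.
  rewrite mem_undup; apply/mapP; exists (u, v) => //.
  by rewrite mem_filter uv; apply/allpairsP; exists (u, v).
rewrite BX inE mem_cat => /or3P[/eqP uv1|/mapP[i _ ->]|/mapP[i _ ->]]; [|by exists i|by exists i; rewrite sqrrN].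
(* Inner product -1 would make [u + v] a vector of norm zero. *)
case/eqP: uNv; apply/eqP; rewrite -addr_eq0; apply/eqP/dotp_eq0.
by rewrite dotp_sqrD !X1 // uv1; ring.
Qed.

(** * Integrality and size of a constant diagonal entry *)

Lemma int_norm_le_floor (R : archiRealFieldType) (k x : R) :
  k \is a Num.int -> `|k| <= x -> `|k| <= (Num.floor x)%:~R.
Proof.
by move=> /intrP[z ->]; rewrite -intr_norm ler_int floor_ge_int.
Qed.

(* Subtracting 1/2 from every entry gives off-diagonal entries +-1/2 without
   raising the bound on the rank, which is sharper than using M itself. *)
Lemma diag_bound_01 (R : realType) (n N : nat) (M : 'M[R]_n) (k : R) :
  (0 < n)%N -> (2 * N <= n)%N -> (forall i, M i i = k) ->
  (forall i j, i != j -> M i j = 0 \/ M i j = 1) ->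
  (forall c, (\rank (M + const_mx c)%R <= N)%N) ->
  k \is a Num.int /\ `|k| <= (U R N)%:~R.
Proof.
move=> n0 Nn Mii Mij rM.
have kint : k \is a Num.int.
  have [|A AE] := @int_mx_lift R n n (M - k%:M).
    move=> i j; rewrite !mxE; case: eqVneq => [->|ij]; first by rewrite Mii subrr.
    by rewrite subr0; have [->|->] := Mij _ _ ij; rewrite ?rpred0 ?rpred1.
  apply: (@int_common_eigenvalue R n N A (A - const_mx 1)) => //.
  - rewrite linearB /= eq_sym -subr_eq0 addrAC subrr add0r oppr_eq0.
    rewrite /mxtrace (eq_bigr (fun=> 1)) => [|i _]; last by rewrite mxE.
    by rewrite sumr_const card_ord pnatr_eq0 -lt0n.
  - by have := rM 0; rewrite -AE subrKC (_ : const_mx 0 = 0) ?addr0 //; apply/matrixP => i j; rewrite !mxE.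
  - have := rM (-1); congr (\rank _ <= _)%N.
    by apply/matrixP => i j; have /matrixP/(_ i j) := AE; rewrite !mxE rmorphB /= => <-; ring.
split=> //; apply: int_norm_le_floor => //.
have : (2 * k - 1) ^+ 2 * (n%:R - N%:R) <= N%:R * (n%:R - 1).
  apply: (@sqr_diag_le_rank R n N (2 *: (M + const_mx (- 2^-1)))) => // [i|i j ij|].
  - by rewrite !mxE Mii; field.
  - by rewrite !mxE; have [->|->] := Mij _ _ ij; lra.
  - by rewrite mxrank_scale_nz // pnatr_eq0.
set nr : R := n%:R; set Nr : R := N%:R => H.
have nr0 : 0 < nr by rewrite ltr0n.
have Nnr : 2 * Nr <= nr by rewrite -natrM ler_nat.
(* This produces the 1/2 outside the square root in [U]. *)
have kle : `|k| <= 2^-1 + `|k - 2^-1|.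
  have half0 : 0 <= 2^-1 :> R by rewrite invr_ge0.
  by have := ler_normD 2^-1 (k - 2^-1); rewrite subrKC (ger0_norm half0).
apply: (le_trans kle); rewrite lerD2l -sqrtr_sqr; apply: ler_wsqrtr.
case: (posnP N) => [N0|N0].
  have Nr0 : Nr = 0 by rewrite /Nr N0.
  rewrite Nr0 expr0n mul0r add0r.
  by move: H; rewrite Nr0 mul0r subr0 pmulr_lle0 //; lra.
have N1 : 1 <= Nr by rewrite ler1n.
(* The value of the bound at [n = 2 * N]; the slack for larger [n] is [(N - 1) * (n - 2 * N)]. *)
have H2 : (2 * k - 1) ^+ 2 <= 2 * Nr - 1.
  have nN : 0 < nr - Nr by lra.
  by rewrite -(ler_pM2r nN); apply: le_trans H _; nra.
(* At [N = 1] the denominator in [U] is zero and the quotient is 0 by convention; [H2] still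
   suffices. *)
have [N1'|N2] : Nr = 1 \/ 1 < Nr by move: N1; rewrite le_eqVlt => /orP[/eqP <-|]; [left|right].
  by rewrite N1'; move: H2; rewrite N1' (_ : 2 * 1 - 2 = 0) ?invr0; lra.
(* Divided by 4, [H2] bounds the square of [k - 1/2] by [(N - 1) / 2 + 1/4]. *)
have : (Nr - 1) / 2 <= Nr ^+ 2 / (2 * Nr - 2).
  by rewrite ler_pdivlMr; [nra | lra].
lra.
Qed.

(** The off-diagonal entries already have modulus at most 1, so no shift is made. The floor in [V]
    is the trace-rank bound at [n = 2 * N + 1]. *)
Lemma diag_bound_pm1 (R : realType) (n N : nat) (M : 'M[R]_n) (k : R) :
  (2 * N < n)%N -> (forall i, M i i = k) ->
  (forall i j, i != j -> [\/ M i j = 0, M i j = 1 | M i j = -1]) ->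
  (\rank M <= N)%N ->
  k \is a Num.int /\ `|k| <= (V R N)%:~R.
Proof.
move=> Nn Mii Mij rM.
have kint : k \is a Num.int.
  have [|A AE] := @int_mx_lift R n n (M - k%:M).
    move=> i j; rewrite !mxE; case: eqVneq => [->|ij]; first by rewrite Mii subrr.
    by rewrite subr0; have [->|->|->] := Mij _ _ ij; rewrite ?rpred0 ?rpredN ?rpred1.
  by apply: (@int_eigenvalue R n N A) => //; rewrite -AE subrKC.
split=> //; apply: int_norm_le_floor => //.
have n0 : (0 < n)%N by lia.
have : k ^+ 2 * (n%:R - N%:R) <= N%:R * (n%:R - 1).
  by apply: (@sqr_diag_le_rank R n N M) => // i j ij; have [->|->|->] := Mij _ _ ij; lra.
set nr : R := n%:R; set Nr : R := N%:R => H.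
have Nnr : 2 * Nr + 1 <= nr by rewrite -natrM natr1 ler_nat.
have N0 : 0 <= Nr by rewrite ler0n.
rewrite -sqrtr_sqr; apply: ler_wsqrtr.
have nN : 0 < nr - Nr by lra.
rewrite ler_pdivlMr; last lra.
rewrite -(ler_pM2r nN) mulrAC.
apply: le_trans (_ : Nr * (nr - 1) * (Nr + 1) <= _); first by apply: ler_wpM2r; [lra | exact: H].
case: (posnP N) => [N00|N1]; first by rewrite (_ : Nr = 0) ?/Nr ?N00 //; lra.
have N1' : 1 <= Nr by rewrite ler1n.
rewrite [2 * _]mulrC expr2 -!mulrA ler_wpM2l //.
(* This product is exactly the slack in the remaining inequality. *)
have : 0 <= (Nr - 1) * (nr - (2 * Nr + 1)) by apply: mulr_ge0; lra.
lra.
Qed.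

(** * Representatives of antipodal pairs, interpolation and conclusion *)

Lemma half_points (R : realType) (d s : nat) (X : seq 'rV[R]_d) (beta : 'I_(s.-1./2) -> R) :
  odd s -> on_unit_sphere X -> antipodal X -> s_distance_set s X ->
  Bset X =i (-1) :: [seq beta i | i <- enum 'I_(s.-1./2)]
                 ++ [seq - beta i | i <- enum 'I_(s.-1./2)] ->
  exists n (y : 'I_n -> 'rV[R]_d), [/\ (0 < n)%N, size X = (2 * n)%N,
    forall a, dotp (y a) (y a) = 1 &
    forall a b, a != b -> exists i, dotp (y a) (y b) ^+ 2 = beta i ^+ 2].
Proof.
move=> s_odd X1 aX sX BX; have [_ _ dotpX] := Bset_beta s_odd X1 sX BX.
have X0 : 0 \notin X.
  apply/negP => /X1; rewrite dotpE big1 => [/esym/eqP|i _]; first by rewrite oner_eq0.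
  by rewrite mxE mul0r.
have [Y [uY YX sizeX YN]] := antipodal_half sX.1 aX X0.
(* The value -1 is attained, so [X] contains a point. *)
have X_gt0 : (0 < size X)%N.
  have := mem_head (-1) ([seq beta i | i <- enum 'I_(s.-1./2)]
                        ++ [seq - beta i | i <- enum 'I_(s.-1./2)]).
  rewrite -BX mem_undup => /mapP[p]; rewrite mem_filter => /andP[_ /allpairsP[q [qX _ _]]] _.
  by case: (X) qX.
have inY (a : 'I_(size Y)) : nth 0 Y a \in Y by rewrite mem_nth.
exists (size Y), (fun a => nth 0 Y a); split=> // [|a|a b ab].
- by rewrite sizeX in X_gt0; lia.
- exact/X1/YX.
by apply: dotpX; rewrite ?YX ?YN // nth_uniq.
Qed.

(** The Lagrange basis polynomial in [t ^+ 2] for the nodes [beta j ^+ 2]; its value at 1 is the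
    product occurring in [k]. *)
Definition lagrange_sqr (F : fieldType) (r : nat) (beta : 'I_r -> F) (i : 'I_r) (t : F) : F :=
  \prod_(j < r | j != i) ((t ^+ 2 - beta j ^+ 2) / (beta i ^+ 2 - beta j ^+ 2)).

Lemma lagrange_sqr_beta (F : fieldType) (r : nat) (beta : 'I_r -> F) (i l : 'I_r) (t : F) :
  (forall j m, j != m -> beta j ^+ 2 != beta m ^+ 2) ->
  t ^+ 2 = beta l ^+ 2 -> lagrange_sqr beta i t = (l == i)%:R.
Proof.
rewrite /lagrange_sqr => beta_sqr_inj tl; case: (eqVneq l i) tl => [->|li] tl.
  apply: big1 => j ji; rewrite tl divff // subr_eq0.
  by apply: beta_sqr_inj; rewrite eq_sym.
by rewrite (bigD1 l) //= tl subrr !mul0r.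
Qed.

(** The factored shape required by [dotp_poly_row_space]; for [r = (s - 1) / 2] the degree in [t] is
    [s - 3]. *)
Lemma lagrange_sqrE (F : fieldType) (r : nat) (beta : 'I_r -> F) (i : 'I_r) :
  exists (a : F) (cs : seq F), size cs = r.-1 /\
  forall t, lagrange_sqr beta i t = a * \prod_(c <- cs) (t ^+ 2 - c).
Proof.
exists (\prod_(j < r | j != i) (beta i ^+ 2 - beta j ^+ 2)^-1).
exists [seq beta j ^+ 2 | j <- enum [pred j | j != i]]; split.
  by rewrite size_map -cardE cardC1 card_ord.
move=> t; rewrite big_map big_enum mulrC -big_split.
by apply: eq_bigl.
Qed.

Unset Implicit Arguments.

Theorem theorem5p2 (R : realType) (d s : nat) (X : seq 'rV[R]_d)
  (beta : 'I_(s.-1./2) -> R) :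
  (5 <= s)%N -> odd s ->
  on_unit_sphere X -> antipodal X -> s_distance_set s X ->
  Bset X =i (-1) :: [seq beta i | i <- enum 'I_(s.-1./2)]
                 ++ [seq - beta i | i <- enum 'I_(s.-1./2)] ->
  (* (1) *)
  ((4 * 'C(d + s - 4, s - 3) <= size X)%N ->
     forall i : 'I_(s.-1./2),
       let k := \prod_(j < s.-1./2 | j != i)
                  ((1 - beta j ^+ 2) / (beta i ^+ 2 - beta j ^+ 2)) in
       k \is a Num.int /\ `|k| <= (U R 'C(d + s - 4, s - 3))%:~R)
  /\
  (* (2) *)
  ((4 * 'C(d + s - 3, s - 2) + 2 <= size X)%N ->
     forall i : 'I_(s.-1./2),
       let k := (beta i)^-1 * \prod_(j < s.-1./2 | j != i)
                  ((1 - beta j ^+ 2) / (beta i ^+ 2 - beta j ^+ 2)) in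
       k \is a Num.int /\ `|k| <= (V R 'C(d + s - 3, s - 2))%:~R).
Proof.
move=> s5 s_odd X1 aX sX BX.
have [beta0 beta_sqr_inj _] := Bset_beta s_odd X1 sX BX.
have [n [y [n0 sizeX y1 ydot]]] := half_points s_odd X1 aX sX BX.
case: d => [|d] in X X1 aX sX BX sizeX y y1 ydot *.
  by have := y1 (Ordinal n0); rewrite dotpE big_ord0 => /esym/eqP; rewrite oner_eq0.
have lag1 i : \prod_(j < s.-1./2 | j != i) ((1 - beta j ^+ 2) / (beta i ^+ 2 - beta j ^+ 2)) =
    lagrange_sqr beta i 1 by rewrite /lagrange_sqr expr1n.
split=> [sizeX4 i k|sizeX4 i k].
- have [Phi PhiP] := dotp_poly_row_space (s - 3) y1.
  have [c0 [cs [size_cs lagE]]] := lagrange_sqrE beta i.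
  pose M : 'M[R]_n := \matrix_(a, b) lagrange_sqr beta i (dotp (y a) (y b)).
  have -> : (d.+1 + s - 4 = s - 3 + d)%N by lia.
  apply: (@diag_bound_01 R n _ M k) => //.
  + move: sizeX4; rewrite sizeX (_ : d.+1 + s - 4 = s - 3 + d)%N; lia.
  + by move=> a; rewrite mxE y1 -lag1.
  + move=> a b /ydot[l dl]; rewrite mxE (lagrange_sqr_beta i beta_sqr_inj dl).
    by case: (l == i); [right|left].
  move=> c; apply: leq_trans (rank_leq_row Phi); apply/mxrankS/row_subP => a.
  (* The constant is an empty product of degree 0; since [s - 3] is even, it is lifted to that
     degree with [j = (s - 3) / 2]. *)
  have -> : row a (M + const_mx c) =
      c0 *: \row_b (\prod_(c <- cs) (dotp (y a) (y b) ^+ 2 - c) * dotp (y a) (y b) ^+ 0)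
      + c *: \row_b (\prod_(c <- [::]) (dotp (y a) (y b) ^+ 2 - c) * dotp (y a) (y b) ^+ 0).
    by apply/rowP => b; rewrite !mxE lagE big_nil !expr0 !mulr1.
  apply: addmx_sub; apply: scalemx_sub.
    by apply: (PhiP _ _ _ 0%N); rewrite size_cs; move: s5 s_odd; lia.
  by apply: (PhiP _ _ _ (s.-1./2.-1)) => /=; move: s5 s_odd; lia.
have [Phi PhiP] := dotp_poly_row_space (s - 2) y1.
have [c0 [cs [size_cs lagE]]] := lagrange_sqrE beta i.
(* The factor [t / beta i] makes the polynomial odd of degree [s - 2], with values 1 and -1 at
   [beta i] and [- beta i]. *)
pose M : 'M[R]_n := \matrix_(a, b)
  ((beta i)^-1 * dotp (y a) (y b) * lagrange_sqr beta i (dotp (y a) (y b))).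
have -> : (d.+1 + s - 3 = s - 2 + d)%N by lia.
apply: (@diag_bound_pm1 R n _ M k) => //.
+ move: sizeX4; rewrite sizeX (_ : d.+1 + s - 3 = s - 2 + d)%N; lia.
+ by move=> a; rewrite mxE y1 -lag1 mulr1.
+ move=> a b /ydot[l dl]; rewrite mxE (lagrange_sqr_beta i beta_sqr_inj dl).
  have [li|_] := eqVneq l i; last by constructor 1; rewrite mulr0.
  move/eqP: dl; rewrite li eqf_sqr mulr1 => /pred2P[->|->].
    by constructor 2; rewrite mulVf.
  by constructor 3; rewrite mulrN mulVf.
apply: leq_trans (rank_leq_row Phi); apply/mxrankS/row_subP => a.
have -> : row a M = ((beta i)^-1 * c0) *:
    \row_b (\prod_(c <- cs) (dotp (y a) (y b) ^+ 2 - c) * dotp (y a) (y b) ^+ 1).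
  by apply/rowP => b; rewrite !mxE lagE expr1; ring.
by apply/scalemx_sub/(PhiP _ _ _ 0%N); rewrite size_cs; move: s5 s_odd; lia.
Qed.
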